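(* For any splitter network $G=(I\uplus S\uplus O,E)$ and any capacity function $c:I\cup O\to[0,1]$, all steady-states $(t,F)$ for $(G,c)$ have the same restriction of $t$ to $\delta^+(I)\cup\delta^-(O)$ (the arcs leaving inputs and the arcs entering outputs).
   Context: A splitter network is a finite directed graph $G$ (loops and parallel arcs allowed) with arc set $E$ whose vertex set is partitioned as $I\uplus S\uplus O$, where each input $i\in I$ has out-degree $1$ and in-degree $0$, each output $o\in O$ has in-degree $1$ and out-degree $0$, and each splitter $s\in S$ has in-degree $2$ and out-degree $2$. $\delta^+(v),\delta^-(v)$ denote outgoing/incoming arcs of $v$. A steady-state for $(G,c)$ is a pair $(t,F)$ with $t:E\to[0,1]$ and $F\subseteq E$ (fluid arcs; arcs of $E\setminus F$ are saturated) such that: (R3) for each input $i$ with $\delta^+(i)=\{e\}$, $t(e)\le c(i)$, and if $e\in F$ then $t(e)=c(i)$; (R4) for each output $o$ with $\delta^-(o)=\{e\}$, $t(e)\le c(o)$, and if $e\notin F$ then $t(e)=c(o)$; (R5) for each splitter $s$, $t(\delta^-(s))=t(\delta^+(s))$; (R6) for each splitter $s$ with $\delta^-(s)=\{e_1,e_2\}$ and $e_1\notin F$, $t(e_1)\ge t(e_2)$; (R7) for each splitter $s$ with $\delta^+(s)=\{e_1,e_2\}$ and $e_1\in F$, $t(e_1)\ge t(e_2)$; (R8) for any arcs $uv\in E\setminus F$ and $vw\in F$, $t(uv)=1$ or $t(vw)=1$. *)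

(* Defs.v *)
From mathcomp Require Import all_boot all_order all_algebra.
From mathcomp Require Import reals.

Set Implicit Arguments.
Unset Strict Implicit.
Unset Printing Implicit Defensive.

Import Order.TTheory GRing.Theory Num.Theory.
Local Open Scope ring_scope.

(* Arcs form a type of their own, with endpoint maps, so that loops and
   parallel arcs are allowed. *)
Record digraph := Digraph {
  vertex_type : finType;
  arc_type : finType;
  src : arc_type -> vertex_type;
  tgt : arc_type -> vertex_type
}.

Definition out_arcs (G : digraph) (v : vertex_type G) : {set arc_type G} :=
  [set e | src e == v].

Definition in_arcs (G : digraph) (v : vertex_type G) : {set arc_type G} :=
  [set e | tgt e == v].

(* The partition is spelled out because the blocks may be empty, which
   finset's [partition] forbids. *)
Record splitter_network := SplitterNetwork {
  graph :> digraph;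
  inputs : {set vertex_type graph};
  splitters : {set vertex_type graph};
  outputs : {set vertex_type graph};
  vertices_cover : inputs :|: splitters :|: outputs = [set: vertex_type graph];
  inputs_splitters_disjoint : [disjoint inputs & splitters];
  inputs_outputs_disjoint : [disjoint inputs & outputs];
  splitters_outputs_disjoint : [disjoint splitters & outputs];
  input_degrees : forall i, i \in inputs ->
    #|out_arcs i| = 1%N /\ #|in_arcs i| = 0%N;
  output_degrees : forall o, o \in outputs ->
    #|in_arcs o| = 1%N /\ #|out_arcs o| = 0%N;
  splitter_degrees : forall s, s \in splitters ->
    #|in_arcs s| = 2%N /\ #|out_arcs s| = 2%N
}.

(* [c] is a total function on vertices, but only its values on inputs and
   outputs are constrained here and used in [steady_state]. *)
Definition capacity (R : realType) (G : splitter_network)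
    (c : vertex_type G -> R) : Prop :=
  forall v, v \in inputs G :|: outputs G -> 0 <= c v <= 1.

(* [F] is the set of fluid arcs, [~: F] the set of saturated arcs.  Since
   splitters have in- and out-degree 2, the arcs [e1] and [e2] below are
   distinct, and each of the two arcs can play the role of [e1]. *)
Record steady_state (R : realType) (G : splitter_network)
    (c : vertex_type G -> R) (t : arc_type G -> R) (F : {set arc_type G}) : Prop :=
  SteadyState {
  throughput_range : forall e, 0 <= t e <= 1;
  input_rule : forall i e, i \in inputs G -> out_arcs i = [set e] ->
    t e <= c i /\ (e \in F -> t e = c i);
  output_rule : forall o e, o \in outputs G -> in_arcs o = [set e] ->
    t e <= c o /\ (e \notin F -> t e = c o);
  conservation_rule : forall s, s \in splitters G ->
    \sum_(e in in_arcs s) t e = \sum_(e in out_arcs s) t e;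
  saturated_in_rule : forall s e1 e2, s \in splitters G ->
    in_arcs s = [set e1; e2] -> e1 \notin F -> t e2 <= t e1;
  fluid_out_rule : forall s e1 e2, s \in splitters G ->
    out_arcs s = [set e1; e2] -> e1 \in F -> t e2 <= t e1;
  maximization_rule : forall e f, tgt e = src f ->
    e \notin F -> f \in F -> t e = 1 \/ t f = 1
}.

Definition boundary_arcs (G : splitter_network) : {set arc_type G} :=
  (\bigcup_(i in inputs G) out_arcs i) :|: (\bigcup_(o in outputs G) in_arcs o).

(* Main.v *)
(** Let [d = t1 - t2], and split the arcs where [d] is nonzero into two classes:
    an arc belongs to the first one if either [d > 0] and it is saturated in the
    second state, or [d < 0] and it is fluid in the first state; the second class
    is obtained by exchanging the two states.  Keeping [d] on the first class only
    gives an arc function [gap] that is nonnegative on the arcs leaving inputs and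
    nonpositive on the arcs entering outputs.  At a splitter, conservation makes
    the excesses (inflow minus outflow) of the two gap functions equal; if they
    were positive, each class would contribute an incoming arc with positive gap
    or an outgoing arc with negative gap, and each of the four combinations
    contradicts one of (R6), (R7), (R8).  So all vertices have nonpositive excess;
    as the excesses sum to zero they all vanish, and at inputs and outputs this
    says that both gap functions, hence [d], are zero there. *)

Require Import Defs.
From mathcomp Require Import all_boot all_order all_algebra.
From mathcomp Require Import reals.
From mathcomp Require Import lra.

Set Implicit Arguments.
Unset Strict Implicit.
Unset Printing Implicit Defensive.

Import Order.TTheory GRing.Theory Num.Theory.
Local Open Scope ring_scope.

Lemma cards2_eq (T : finType) (A : {set T}) (x y : T) :
  #|A| = 2%N -> x \in A -> y \in A -> x != y -> A = [set x; y].
Proof.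
move=> cA xA yA xy; apply/esym/eqP.
by rewrite eqEcard subUset !sub1set xA yA cards2 xy cA.
Qed.

Lemma sumB_gt0_witness (R : realDomainType) (T : finType) (A B : {set T})
    (f : T -> R) : 0 < \sum_(e in A) f e - \sum_(e in B) f e ->
  (exists2 e, e \in A & 0 < f e) \/ (exists2 e, e \in B & f e < 0).
Proof.
have [/exists_inP|/exists_inPn noA] := boolP [exists e in A, 0 < f e]; first by left.
have [/exists_inP|/exists_inPn noB] := boolP [exists e in B, f e < 0]; first by right.
rewrite ltNge subr_le0 (@le_trans _ _ 0) //.
  by apply: sumr_le0 => e /noA; rewrite -leNgt.
by apply: sumr_ge0 => e /noB; rewrite -leNgt.
Qed.

Section Excess.
Variables (R : realType) (G : digraph).
Implicit Types (f : arc_type G -> R) (v : vertex_type G).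

Definition excess f v : R :=
  \sum_(e in in_arcs v) f e - \sum_(e in out_arcs v) f e.

(** Each arc contributes [f e] once at its head and [- f e] once at its tail. *)
Lemma sum_excess f : \sum_v excess f v = 0.
Proof.
rewrite sumrB; apply/eqP; rewrite subr_eq0; apply/eqP.
transitivity (\sum_e f e).
  rewrite (partition_big (@tgt G) predT) //=.
  by apply: eq_bigr => v _; apply: eq_bigl => e; rewrite inE.
rewrite (partition_big (@src G) predT) //=.
by apply: eq_bigr => v _; apply: eq_bigl => e; rewrite inE.
Qed.

Lemma excess_le0_eq0 f : (forall v, excess f v <= 0) -> forall v, excess f v = 0.
Proof.
move=> f_le0 v; apply/eqP; rewrite -oppr_eq0; apply/eqP; move: v.
have /psumr_eq0P ex0 : forall v, predT v -> 0 <= - excess f v.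
  by move=> v _; rewrite oppr_ge0.
by move=> v; apply: ex0; rewrite // sumrN sum_excess oppr0.
Qed.

End Excess.

Section SplitterNetwork.
Variables (R : realType) (G : splitter_network).
Implicit Types (i s o : vertex_type G) (e : arc_type G) (f : arc_type G -> R).

Lemma excess_input f i e :
  i \in inputs G -> e \in out_arcs i -> excess f i = - f e.
Proof.
move=> /input_degrees[/eqP/cards1P[e' out_i] /cards0_eq in_i].
by rewrite out_i inE => /eqP->; rewrite /excess in_i out_i big_set0 big_set1 sub0r.
Qed.

Lemma excess_output f o e :
  o \in outputs G -> e \in in_arcs o -> excess f o = f e.
Proof.
move=> /output_degrees[/eqP/cards1P[e' in_o] /cards0_eq out_o].
by rewrite in_o inE => /eqP->; rewrite /excess in_o out_o big_set0 big_set1 subr0.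
Qed.

End SplitterNetwork.

Section SteadyState.
Variables (R : realType) (G : splitter_network) (c : vertex_type G -> R).
Variables (t : arc_type G -> R) (F : {set arc_type G}).
Hypothesis ss : steady_state c t F.

Lemma input_arc_rule i e : i \in inputs G -> e \in out_arcs i ->
  t e <= c i /\ (e \in F -> t e = c i).
Proof.
move=> iI; have [/eqP/cards1P[e' out_i] _] := input_degrees iI.
by rewrite out_i inE => /eqP->; apply: (input_rule ss).
Qed.

Lemma output_arc_rule o e : o \in outputs G -> e \in in_arcs o ->
  t e <= c o /\ (e \notin F -> t e = c o).
Proof.
move=> oO; have [/eqP/cards1P[e' in_o] _] := output_degrees oO.
by rewrite in_o inE => /eqP->; apply: (output_rule ss).
Qed.

(** Allowing [e1 = e2] lets the rule apply to two witnesses found independently. *)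
Lemma saturated_in_max s e1 e2 : s \in splitters G ->
  e1 \in in_arcs s -> e2 \in in_arcs s -> e1 \notin F -> t e2 <= t e1.
Proof.
move=> sS e1s e2s; have [->//|ne12] := eqVneq e1 e2.
have [in_s _] := splitter_degrees sS.
exact: (saturated_in_rule ss sS (cards2_eq in_s e1s e2s ne12)).
Qed.

Lemma fluid_out_max s e1 e2 : s \in splitters G ->
  e1 \in out_arcs s -> e2 \in out_arcs s -> e1 \in F -> t e2 <= t e1.
Proof.
move=> sS e1s e2s; have [->//|ne12] := eqVneq e1 e2.
have [_ out_s] := splitter_degrees sS.
exact: (fluid_out_rule ss sS (cards2_eq out_s e1s e2s ne12)).
Qed.

End SteadyState.

Section Gap.
Variables (R : realType) (G : splitter_network).
Implicit Types (t : arc_type G -> R) (F : {set arc_type G}).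

Definition gap t1 F1 t2 F2 (e : arc_type G) : R :=
  if (t2 e < t1 e) && (e \notin F2) || (t1 e < t2 e) && (e \in F1)
  then t1 e - t2 e else 0.

Lemma gap_gt0 t1 F1 t2 F2 e :
  0 < gap t1 F1 t2 F2 e -> t2 e < t1 e /\ e \notin F2.
Proof.
rewrite /gap; case: ifP => [|_]; last by rewrite ltxx.
by rewrite subr_gt0 => + lt21; rewrite lt21 (lt_gtF lt21) /= orbF => ->.
Qed.

Lemma gap_lt0 t1 F1 t2 F2 e :
  gap t1 F1 t2 F2 e < 0 -> t1 e < t2 e /\ e \in F1.
Proof.
rewrite /gap; case: ifP => [|_]; last by rewrite ltxx.
by rewrite subr_lt0 => + lt12; rewrite lt12 (lt_gtF lt12) /= => ->.
Qed.

(** An arc with [t1 e != t2 e] lies in exactly one class: membership in [F2] decides if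
    [t2 e < t1 e], membership in [F1] if [t1 e < t2 e]. *)
Lemma gapB t1 F1 t2 F2 e :
  gap t1 F1 t2 F2 e - gap t2 F2 t1 F1 e = t1 e - t2 e.
Proof.
rewrite /gap; case: ltgtP => [||->]; last by rewrite !subrr.
  by case: (e \in F2); rewrite /= ?subr0 ?sub0r ?opprB.
by case: (e \in F1); rewrite /= ?subr0 ?sub0r ?opprB.
Qed.

Variable c : vertex_type G -> R.

(** The two excesses differ by the excess of [t1 - t2], which vanishes by conservation in both
    states. *)
Lemma excess_gapC t1 F1 t2 F2 s :
  steady_state c t1 F1 -> steady_state c t2 F2 -> s \in splitters G ->
  excess (gap t1 F1 t2 F2) s = excess (gap t2 F2 t1 F1) s.
Proof.
move=> h1 h2 sS; apply/eqP; rewrite -subr_eq0 /excess.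
have sum_gapB (A : {set arc_type G}) :
    \sum_(e in A) gap t1 F1 t2 F2 e - \sum_(e in A) gap t2 F2 t1 F1 e
    = \sum_(e in A) t1 e - \sum_(e in A) t2 e.
  by rewrite -!sumrB; apply: eq_bigr => e _; apply: gapB.
move: (sum_gapB (in_arcs s)) (sum_gapB (out_arcs s)).
rewrite (conservation_rule h1 sS) (conservation_rule h2 sS) => in_s out_s.
by apply/eqP; lra.
Qed.

Lemma excess_gap_splitter t1 F1 t2 F2 s :
  steady_state c t1 F1 -> steady_state c t2 F2 -> s \in splitters G ->
  excess (gap t1 F1 t2 F2) s <= 0.
Proof.
move=> h1 h2 sS; rewrite leNgt; apply/negP => ex12.
have ex21 := ex12; rewrite (excess_gapC h1 h2 sS) in ex21.
have arcE e f : e \in in_arcs s -> f \in out_arcs s -> tgt e = src f.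
  by rewrite !inE => /eqP-> /eqP->.
case/sumB_gt0_witness: ex12 => [][e es].
- case/gap_gt0 => lt_e eF2.
  case/sumB_gt0_witness: ex21 => [][f fs].
  + case/gap_gt0 => lt_f fF1.
    (* Two incoming arcs: (R6) closes the cycle [t1 e <= t1 f < t2 f <= t2 e < t1 e]. *)
    have := saturated_in_max h1 sS fs es fF1.
    by have := saturated_in_max h2 sS es fs eF2; lra.
  + case/gap_lt0 => lt_f fF2.
    (* (R8) puts [t2 e] or [t2 f] at 1, yet both lie strictly below their values under [t1]. *)
    have := throughput_range h1 e; have := throughput_range h1 f.
    by case: (maximization_rule h2 (arcE _ _ es fs) eF2 fF2); lra.
- case/gap_lt0 => lt_e eF1.
  case/sumB_gt0_witness: ex21 => [][f fs].
  + case/gap_gt0 => lt_f fF1.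
    have := throughput_range h2 e; have := throughput_range h2 f.
    by case: (maximization_rule h1 (arcE _ _ fs es) fF1 eF1); lra.
  + case/gap_lt0 => lt_f fF2.
    have := fluid_out_max h1 sS es fs eF1.
    by have := fluid_out_max h2 sS fs es fF2; lra.
Qed.

Lemma excess_gap_le0 t1 F1 t2 F2 v :
  steady_state c t1 F1 -> steady_state c t2 F2 ->
  excess (gap t1 F1 t2 F2) v <= 0.
Proof.
move=> h1 h2; have : v \in [set: vertex_type G] by rewrite inE.
rewrite -vertices_cover !inE => /orP[/orP[vI|vS]|vO].
- have [/eqP/cards1P[e out_v] _] := input_degrees vI.
  have ev : e \in out_arcs v by rewrite out_v inE.
  rewrite (excess_input _ vI ev) oppr_le0 leNgt; apply/negP => /gap_lt0[lt_e eF1].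
  (* Being fluid in the first state forces [t1 e = c v], which bounds [t2 e]. *)
  have [_ /(_ eF1)] := input_arc_rule h1 vI ev.
  by have [] := input_arc_rule h2 vI ev; lra.
- exact: excess_gap_splitter.
- have [/eqP/cards1P[e in_v] _] := output_degrees vO.
  have ev : e \in in_arcs v by rewrite in_v inE.
  rewrite (excess_output _ vO ev) leNgt; apply/negP => /gap_gt0[lt_e eF2].
  (* Being saturated in the second state forces [t2 e = c v], which bounds [t1 e]. *)
  have [_ /(_ eF2)] := output_arc_rule h2 vO ev.
  by have [] := output_arc_rule h1 vO ev; lra.
Qed.

Lemma gap_boundary_eq0 t1 F1 t2 F2 :
  steady_state c t1 F1 -> steady_state c t2 F2 ->
  {in boundary_arcs G, forall e, gap t1 F1 t2 F2 e = 0}.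
Proof.
move=> h1 h2 e.
have ex0 := excess_le0_eq0 (fun v => excess_gap_le0 v h1 h2).
rewrite inE => /orP[/bigcupP[i iI ei]|/bigcupP[o oO eo]].
  by apply/oppr_inj; rewrite -(excess_input _ iI ei) ex0 oppr0.
by rewrite -(excess_output _ oO eo) ex0.
Qed.

End Gap.

Theorem theorem8 (R : realType) (G : splitter_network)
    (c : vertex_type G -> R) (hc : capacity c)
    (t1 t2 : arc_type G -> R) (F1 F2 : {set arc_type G})
    (h1 : steady_state c t1 F1) (h2 : steady_state c t2 F2) :
  {in boundary_arcs G, t1 =1 t2}.
Proof.
move=> e eB; apply/eqP; rewrite -subr_eq0 -(gapB t1 F1 t2 F2).
by rewrite (gap_boundary_eq0 h1 h2 eB) (gap_boundary_eq0 h2 h1 eB) subrr.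
Qed.
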